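(* For all $0<\lambda<\lambda'$ and all dynamic metric spaces $\gamma_X,\gamma_Y$, $$d_{\mathrm I,\lambda'}^{\mathrm{dynM}}(\gamma_X,\gamma_Y)\le d_{\mathrm I,\lambda}^{\mathrm{dynM}}(\gamma_X,\gamma_Y)\le\frac{\lambda'}{\lambda}\, d_{\mathrm I,\lambda'}^{\mathrm{dynM}}(\gamma_X,\gamma_Y).$$
   Context: A dynamic metric space (DMS) is a pair $\gamma_X=(X,d_X(\cdot))$ where $X$ is a nonempty finite set and $d_X:\mathbb{R}\times X\times X\to\mathbb{R}_+$ satisfies: (i) for each $t\in\mathbb{R}$, $(X,d_X(t))$ is a pseudo-metric space; (ii) for $x\ne x'$ in $X$ the function $t\mapsto d_X(t)(x,x')$ is not identically zero; (iii) for all $x,x'\in X$ the function $t\mapsto d_X(t)(x,x')$ is continuous. A tripod $R$ between $X$ and $Y$ is a set $Z$ with surjections $\varphi_X:Z\to X$ and $\varphi_Y:Z\to Y$. For $d_1:X\times X\to\mathbb{R}$ and $d_2:Y\times Y\to\mathbb{R}$, $d_1\le_Rd_2$ means $d_1(\varphi_X(z),\varphi_X(z'))\le d_2(\varphi_Y(z),\varphi_Y(z'))$ for all $z,z'\in Z$ (and symmetrically for $d_2\le_R d_1$). For $t\in\mathbb{R}$, $\varepsilon\ge0$, $[t]^\varepsilon=[t-\varepsilon,t+\varepsilon]$ and $\big(\bigvee_{[t]^\varepsilon}d_X\big)(x,x')=\min_{s\in[t]^\varepsilon}d_X(s)(x,x')$. For $\lambda\ge0$, $R$ is a $(\lambda,\varepsilon)$-tripod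 between $\gamma_X$ and $\gamma_Y$ if for all $t\in\mathbb{R}$, $\bigvee_{[t]^\varepsilon}d_X\le_Rd_Y(t)+\lambda\varepsilon$ and $\bigvee_{[t]^\varepsilon}d_Y\le_Rd_X(t)+\lambda\varepsilon$. The $\lambda$-distortion $\mathrm{dis}^{\mathrm{dyn}}_\lambda(R)$ is the infimum of $\varepsilon\ge0$ such that $R$ is a $(\lambda,\varepsilon)$-tripod ($+\infty$ if none), and $d_{\mathrm I,\lambda}^{\mathrm{dynM}}(\gamma_X,\gamma_Y)=\min_R\mathrm{dis}^{\mathrm{dyn}}_\lambda(R)$ over all tripods $R$ between $X$ and $Y$. *)

(* Defs.v *)
From HB Require Import structures.
From mathcomp Require Import all_boot all_order all_algebra.
From mathcomp Require Import all_classical all_reals all_analysis.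
Set Implicit Arguments.
Unset Strict Implicit.
Unset Printing Implicit Defensive.
Import Order.TTheory GRing.Theory Num.Theory.
Import numFieldNormedType.Exports.
Local Open Scope classical_set_scope.
Local Open Scope ring_scope.

Record pseudometric (R : realType) (X : Type) (d : X -> X -> R) : Prop := {
  pseudometric_ge0 : forall x y, 0 <= d x y;
  pseudometric_refl : forall x, d x x = 0;
  pseudometric_sym : forall x y, d x y = d y x;
  pseudometric_triangle : forall x y z, d x z <= d x y + d y z
}.

Record dms (R : realType) := DMS {
  dms_carrier :> finType;
  dms_dist : R -> dms_carrier -> dms_carrier -> R;
  dms_nonempty : (0 < #|dms_carrier|)%N;
  dms_pseudometric : forall t, pseudometric (dms_dist t);
  dms_not_identically0 :
    forall x x', x <> x' -> ~ (forall t, dms_dist t x x' = 0);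
  dms_continuous : forall x x', continuous (fun t => dms_dist t x x')
}.

(* The apex is an arbitrary type: it is not required to be finite. *)
Record tripod (X Y : Type) := Tripod {
  tripod_apex : Type;
  tripod_left : tripod_apex -> X;
  tripod_right : tripod_apex -> Y;
  tripod_left_surj : set_surj [set: tripod_apex] [set: X] tripod_left;
  tripod_right_surj : set_surj [set: tripod_apex] [set: Y] tripod_right
}.
Arguments tripod_left {X Y} t z.
Arguments tripod_right {X Y} t z.

(* [d1 <=_R d2] is [le_along (tripod_left T) (tripod_right T) d1 d2], and
   [d2 <=_R d1] is [le_along (tripod_right T) (tripod_left T) d2 d1]. *)
Definition le_along (R : realType) (Z X Y : Type) (f : Z -> X) (g : Z -> Y)
    (d1 : X -> X -> R) (d2 : Y -> Y -> R) : Prop :=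
  forall z z', d1 (f z) (f z') <= d2 (g z) (g z').

(* An infimum, attained when [0 <= eps] and [d] is continuous in time: see
   [window_min_attained]. *)
Definition window_min (R : realType) (X : Type) (d : R -> X -> X -> R)
    (eps t : R) (x x' : X) : R :=
  inf [set d s x x' | s in `[t - eps, t + eps]].

Definition is_lambda_eps_tripod (R : realType) (X Y : dms R)
    (lambda eps : R) (T : tripod X Y) : Prop :=
  forall t,
    le_along (tripod_left T) (tripod_right T)
      (window_min (@dms_dist R X) eps t)
      (fun y y' => dms_dist t y y' + lambda * eps) /\
    le_along (tripod_right T) (tripod_left T)
      (window_min (@dms_dist R Y) eps t)
      (fun x x' => dms_dist t x x' + lambda * eps).

Definition dyn_distortion (R : realType) (X Y : dms R) (lambda : R)
    (T : tripod X Y) : \bar R :=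
  ereal_inf [set eps%:E | eps in
    [set eps : R | 0 <= eps /\ is_lambda_eps_tripod lambda eps T]].

(* An infimum over all tripods, which is attained: see
   [dyn_interleaving_attained]. The index set is written with [exists] rather than
   as the image of [[set: tripod X Y]], which would force the universe of the
   apices below that of the finite types, excluding the apex [X * Y]. *)
Definition dyn_interleaving (R : realType) (lambda : R) (X Y : dms R) : \bar R :=
  ereal_inf [set e | exists T : tripod X Y, e = dyn_distortion lambda T].

Lemma window_min_attained (R : realType) (X : dms R) (eps t : R) (x x' : X) :
  0 <= eps ->
  exists2 s, s \in `[t - eps, t + eps] &
    window_min (@dms_dist R X) eps t x x' = dms_dist s x x' /\
    (forall u, u \in `[t - eps, t + eps] -> dms_dist s x x' <= dms_dist u x x').
Proof.
move=> eps0.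
have le_te : t - eps <= t + eps by rewrite lerD2l ge0_cp.
have [s sI smin] := @EVT_min R (fun s => dms_dist s x x') _ _ le_te
  (continuous_subspaceT (@dms_continuous R X x x')).
exists s => //; split=> //.
rewrite /window_min; set A := image _ _.
have lbA : lbound A (dms_dist s x x').
  by move=> _ [u uI <-]; apply: smin.
apply/eqP; rewrite eq_le; apply/andP; split.
  by apply: ge_inf; [exists (dms_dist s x x') | exists s].
by apply: lb_le_inf => //; exists (dms_dist s x x'), s.
Qed.

(* The distortion depends only on the correspondence induced on [X * Y], so it
   takes finitely many values. *)
Lemma dyn_interleaving_attained (R : realType) (lambda : R) (X Y : dms R) :
  exists T : tripod X Y,
    dyn_interleaving lambda X Y = dyn_distortion lambda T /\
    (forall T' : tripod X Y,
       (dyn_distortion lambda T <= dyn_distortion lambda T')%E).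
Proof.
pose cor (T : tripod X Y) : {set X * Y} := [set p |
  `[< exists z, (tripod_left T z, tripod_right T z) = p >]]%SET.
have corE (T : tripod X Y) z : (tripod_left T z, tripod_right T z) \in cor T.
  by rewrite inE; apply/asboolP; exists z.
have le_al (T T' : tripod X Y) eps : cor T = cor T' ->
    is_lambda_eps_tripod lambda eps T -> is_lambda_eps_tripod lambda eps T'.
  move=> eTT' H t; have [H1 H2] := H t.
  have pull z' : exists z, tripod_left T z = tripod_left T' z' /\
      tripod_right T z = tripod_right T' z'.
    have := corE T' z'; rewrite -eTT' inE => /asboolP[z [e1 e2]].
    by exists z.
  by split=> z z'; have [w [<- <-]] := pull z; have [w' [<- <-]] := pull z';
    [exact: H1 | exact: H2].
have dis_cor (T T' : tripod X Y) : cor T = cor T' ->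
    dyn_distortion lambda T = dyn_distortion lambda T'.
  move=> eTT'; congr ereal_inf; apply/seteqP; split=> _ [e [e0 He] <-];
    by exists e => //; split=> //; apply: le_al He.
have /card_gt0P[x0 _] := dms_nonempty X.
have /card_gt0P[y0 _] := dms_nonempty Y.
have sX : set_surj [set: X * Y] [set: X] fst by move=> x _; exists (x, y0).
have sY : set_surj [set: X * Y] [set: Y] snd by move=> y _; exists (x0, y).
pose T0 := Tripod sX sY.
pose rep (C : {set X * Y}) : tripod X Y :=
  if pselect (exists T, cor T = C) is left e then projT1 (cid e) else T0.
have repP T : dyn_distortion lambda (rep (cor T)) = dyn_distortion lambda T.
  apply: dis_cor; rewrite /rep; case: pselect => [e|[]]; last by exists T.
  by case: cid.
pose C := [arg min_(C < cor T0) dyn_distortion lambda (rep C)]%O.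
have min_C (T' : tripod X Y) :
    (dyn_distortion lambda (rep C) <= dyn_distortion lambda T')%E.
  by rewrite -(repP T') /C; case: arg_minP => // i _; apply.
exists (rep C); split=> //; apply/eqP; rewrite eq_le; apply/andP; split.
  by apply: ereal_inf_lbound; exists (rep C).
by apply: le_ereal_inf_tmp => _ [T' ->].
Qed.

(* Main.v *)
(** Enlarging [lambda] weakens the tripod condition at a fixed [eps].
   Conversely a [(lambda', eps)]-tripod is a [(lambda, c * eps)]-tripod for
   [c = lambda' / lambda]: the slack [lambda * (c * eps) = lambda' * eps] is
   unchanged, and since [c >= 1] the minima over the larger windows only drop. *)
Require Import Defs.
From mathcomp Require Import all_boot all_order all_algebra.
From mathcomp Require Import all_classical all_reals all_analysis.
Import Order.TTheory GRing.Theory Num.Theory.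
Local Open Scope ring_scope.

Lemma window_min_le (R : realType) (X : dms R) (eps eps' t : R) (x x' : X) :
  0 <= eps -> eps <= eps' ->
  window_min (@dms_dist R X) eps' t x x' <= window_min (@dms_dist R X) eps t x x'.
Proof.
move=> eps0 le_eps.
(* The minimiser [s] over the smaller window also competes in the larger one. *)
have [s sI [-> _]] := window_min_attained t x x' eps0.
have [u _ [-> umin]] := window_min_attained t x x' (le_trans eps0 le_eps).
apply: umin; move: sI; rewrite !in_itv /= => /andP[s1 s2].
by rewrite (le_trans _ s1) ?lerB// (le_trans s2)// lerD2l.
Qed.

Lemma is_lambda_eps_tripod_le (R : realType) (X Y : dms R)
    (lambda lambda' eps eps' : R) (T : tripod X Y) :
  0 <= eps -> eps <= eps' -> lambda * eps <= lambda' * eps' ->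
  is_lambda_eps_tripod lambda eps T -> is_lambda_eps_tripod lambda' eps' T.
Proof.
move=> eps0 le_eps le_slack H t; have [HXY HYX] := H t.
split=> z z'; apply: (le_trans (window_min_le _ _ _ _ _ _ _ eps0 le_eps)).
- by apply: (le_trans (HXY z z')); rewrite lerD2l.
- by apply: (le_trans (HYX z z')); rewrite lerD2l.
Qed.

(** A free factor [c] makes both inequalities instances of one bound: [c = 1] when the weight grows,
    the ratio of the weights when it shrinks. *)
Lemma dyn_distortion_le (R : realType) (X Y : dms R) (lambda lambda' c : R)
    (T : tripod X Y) :
  1 <= c -> lambda' <= lambda * c ->
  (dyn_distortion lambda T <= c%:E * dyn_distortion lambda' T)%E.
Proof.
move=> c1 le_lambda; have c0 : 0 < c by apply: lt_le_trans c1.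
(* Moving [c] to the left isolates the infimum, which can then be tested at each admissible
   [eps]. *)
rewrite -lee_pdivrMl//; apply: le_ereal_inf_tmp => _ [eps [eps0 epsT] <-].
rewrite lee_pdivrMl// -EFinM; apply: ereal_inf_lbound; exists (c * eps) => //.
split; first by rewrite mulr_ge0// ltW.
apply: is_lambda_eps_tripod_le epsT => //; first by rewrite ler_peMl.
by rewrite mulrA ler_wpM2r.
Qed.

Lemma dyn_interleaving_le (R : realType) (X Y : dms R) (lambda lambda' c : R) :
  1 <= c -> lambda' <= lambda * c ->
  (dyn_interleaving lambda X Y <= c%:E * dyn_interleaving lambda' X Y)%E.
Proof.
(* A tripod optimal for [lambda'] serves as a competitor for [lambda]. *)
move=> c1 le_lambda; have [T [-> _]] := dyn_interleaving_attained lambda' X Y.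
apply: le_trans (dyn_distortion_le _ _ _ _ _ _ T c1 le_lambda).
by apply: ereal_inf_lbound; exists T.
Qed.

Theorem propositionA15 (R : realType) (lambda lambda' : R)
    (lambda_gt0 : 0 < lambda) (lambda_lt : lambda < lambda')
    (X Y : dms R) :
  (dyn_interleaving lambda' X Y <= dyn_interleaving lambda X Y)%E /\
  (dyn_interleaving lambda X Y
     <= (lambda' / lambda)%:E * dyn_interleaving lambda' X Y)%E.
Proof.
split.
  (* Here [c = 1], with the two weights exchanged. *)
  rewrite -[leRHS]mul1e; apply: dyn_interleaving_le => //.
  by rewrite mulr1 ltW.
apply: dyn_interleaving_le; first by rewrite ler_pdivlMr// mul1r ltW.
by rewrite mulrCA divff ?mulr1// gt_eqF.
Qed.
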